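(* Let $k\ge 2$, let $n_1,\dots,n_k\ge 1$, $n=n_1+\cdots+n_k$, and let \[A=\begin{bmatrix} 0 & A_1 & & \\ & 0 & \ddots & \\ & & \ddots & A_{k-1} \\ & & & 0\end{bmatrix}\quad\text{on } \mathbb{C}^n=\mathbb{C}^{n_1}\oplus\cdots\oplus\mathbb{C}^{n_k}\] be an $n$-by-$n$ block shift, where $A_j$ is a complex $n_j$-by-$n_{j+1}$ matrix for $1\le j\le k-1$. Let \[A'=\begin{bmatrix} 0 & \|A_1\| & & \\ & 0 & \ddots & \\ & & \ddots & \|A_{k-1}\| \\ & & & 0\end{bmatrix}\quad\text{on } \mathbb{C}^k.\] Then: (a) $w(A)\le w(A')$; (b) under the assumption that $A_j\ne 0$ for all $j$, $w(A)=w(A')$ if and only if $A$ is unitarily similar to $A'\oplus B$, where $B$ is a block shift with $w(B)\le w(A')$.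
   Context: $\|\cdot\|$ denotes the operator norm of a matrix (with respect to the Euclidean norms). The numerical radius of a square complex matrix $B$ of size $n$ is $w(B)=\max\{|\langle Bx,x\rangle| : x\in\mathbb{C}^n,\ \|x\|=1\}$. A block shift is a square complex matrix which, with respect to some decomposition $\mathbb{C}^{m_1}\oplus\cdots\oplus\mathbb{C}^{m_l}$ of the underlying space ($l\ge 1$), has the block form with (in general rectangular) matrices $B_1,\dots,B_{l-1}$ on the first block superdiagonal, $B_j$ of size $m_j$-by-$m_{j+1}$, and zero blocks elsewhere (in particular, zero diagonal blocks). The number and sizes of the blocks of the block shift $B$ need not be those of $A$, and the summand $B$ is allowed to be absent (to act on a $0$-dimensional space), in which case the condition $w(B)\le w(A')$ is vacuous. *)

(* Defs.v *)
From mathcomp Require Import all_boot all_order all_algebra.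
From mathcomp Require Import boolp classical_sets reals.
From mathcomp Require Import complex.

Set Implicit Arguments.
Unset Strict Implicit.
Unset Printing Implicit Defensive.

Import Order.TTheory GRing.Theory Num.Theory.

Local Open Scope ring_scope.
Local Open Scope complex_scope.
Local Open Scope sesquilinear_scope.
Local Open Scope classical_set_scope.

(* Vectors of C^n are columns, while [dotmx] takes rows; the form is linear in
   its first argument: <x, y> = \sum_i x_i * (y_i)^*. *)
Definition inner (R : realType) (n : nat) (x y : 'cV[R[i]]_n) : R[i] :=
  dotmx x^T y^T.

Definition enorm (R : realType) (n : nat) (x : 'cV[R[i]]_n) : R :=
  Num.sqrt (complex.Re (inner x x)).

Definition opnorm (R : realType) (m n : nat) (M : 'M[R[i]]_(m, n)) : R :=
  sup [set enorm (M *m x) | x in [set x : 'cV[R[i]]_n | enorm x <= 1]].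

(* The norm of R[i] takes its (real) values in R[i], hence the real part.
   The unit sphere is compact, so for 0 < n this supremum is a maximum; for
   n = 0 the sphere is empty and the value is [sup set0 = 0]. *)
Definition numradius (R : realType) (n : nat) (B : 'M[R[i]]_n) : R :=
  sup [set complex.Re `|inner (B *m x) x|
        | x in [set x : 'cV[R[i]]_n | enorm x = 1]].

(* Only the blocks A i j with j = i + 1 are used: they are the
   superdiagonal blocks, counted from 0. Carrying the whole family avoids casts
   between block sizes. *)
Definition blockshift (R : realType) (k : nat) (n : 'I_k -> nat)
    (A : forall i j : 'I_k, 'M[R[i]]_(n i, n j)) : 'M[R[i]]_(\sum_(i < k) n i) :=
  \mxblock_(i < k, j < k) (if j == i.+1 :> nat then A i j else 0).

Definition normshift (R : realType) (k : nat) (n : 'I_k -> nat)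
    (A : forall i j : 'I_k, 'M[R[i]]_(n i, n j)) : 'M[R[i]]_k :=
  \matrix_(i < k, j < k) (if j == i.+1 :> nat then (opnorm (A i j))%:C else 0).

Definition dirsum (R : realType) (m n : nat)
    (M : 'M[R[i]]_m) (N : 'M[R[i]]_n) : 'M[R[i]]_(m + n) :=
  block_mx M 0 0 N.

(* The sizes p and q are equal only propositionally in the intended uses, so U
   is typed as a p-by-q matrix; that both U U^* and U^* U are identities
   forces p = q. *)
Definition unitarily_similar (R : realType) (p q : nat)
    (M : 'M[R[i]]_p) (N : 'M[R[i]]_q) : Prop :=
  exists U : 'M[R[i]]_(p, q),
    [/\ U \is unitarymx, U^t* \is unitarymx & M = U *m N *m U^t*].

(* Main.v *)
Require Import Defs.
From mathcomp Require Import all_boot all_order all_algebra.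
From mathcomp Require Import boolp classical_sets reals complex.
From mathcomp Require Import ring lra.

(* With [y i] the norm of the block [x i], Cauchy-Schwarz bounds [<Ax,x>] by
   [<A'y,y>], which gives (a). The numerical range of a block shift is
   circularly symmetric, so its numerical radius is the largest eigenvalue of
   [(A + A^* )/2] and is attained as [Re <Ax,x>]. If the radii agree, [y]
   maximizes the form of [A'], hence has positive entries (Perron-Frobenius for
   a path), and every Cauchy-Schwarz inequality is an equality: the normalized
   blocks [v i] of [x] satisfy [A_i v_(i+1) = |A_i| v_i] and
   [A_i^* v_i = |A_i| v_(i+1)]. Their span reduces [A] to [A'], and the blocks
   orthogonal to the [v i] carry the complementary block shift. *)

Set Implicit Arguments.
Unset Strict Implicit.
Unset Printing Implicit Defensive.

Import Order.TTheory GRing.Theory Num.Theory.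

Local Open Scope ring_scope.
Local Open Scope complex_scope.
Local Open Scope sesquilinear_scope.

(** * Inner product, Cauchy-Schwarz and maximization of a normal form *)

Section InnerProduct.
Variable R : realType.
Implicit Types m n p : nat.
Local Notation C := R[i].

Lemma ReD (a b : C) : complex.Re (a + b) = complex.Re a + complex.Re b.
Proof. by case: a b => ? ? []. Qed.

Lemma Re_conj (a : C) : complex.Re a^* = complex.Re a.
Proof. by case: a. Qed.

Lemma Re_sum (I : Type) (r : seq I) (P : pred I) (F : I -> C) :
  complex.Re (\sum_(i <- r | P i) F i) = \sum_(i <- r | P i) complex.Re (F i).
Proof. by elim/big_rec2: _ => // i _ b _ <-; rewrite ReD. Qed.

Lemma ReZ (a : R) (b : C) : complex.Re (a%:C * b) = a * complex.Re b.
Proof. by case: b => b c /=; rewrite mul0r subr0. Qed.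

Lemma Re_mul_real (a b : C) : 0 <= b -> complex.Re (a * b) = complex.Re a * complex.Re b.
Proof. by move=> /ger0_Im; case: a b => a a' [b b'] /= ->; rewrite mulr0 subr0. Qed.

Lemma tC_mul m n p (M : 'M[C]_(m, n)) (N : 'M[C]_(n, p)) :
  (M *m N)^t* = N^t* *m M^t*.
Proof. by rewrite trmx_mul map_mxM. Qed.

Lemma tCD m n (M N : 'M[C]_(m, n)) : (M + N)^t* = M^t* + N^t*.
Proof. by rewrite linearD map_mxD. Qed.

Lemma tCZ m n (a : C) (M : 'M[C]_(m, n)) : (a *: M)^t* = a^* *: M^t*.
Proof. by rewrite linearZ map_mxZ. Qed.

Lemma innerE n (x y : 'cV[C]_n) : inner x y = (y^t* *m x) 0 0.
Proof.
rewrite /inner dotmxE !mxE; apply: eq_bigr => i _.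
by rewrite !mxE mulrC.
Qed.

Lemma inner_sum n (x y : 'cV[C]_n) :
  inner x y = \sum_i (y i 0)^* * x i 0.
Proof. by rewrite innerE !mxE; apply: eq_bigr => i _; rewrite !mxE. Qed.

Lemma inner_adj m n (M : 'M[C]_(m, n)) x y :
  inner (M *m x) y = inner x (M^t* *m y).
Proof. by rewrite !innerE tC_mul trmxCK mulmxA. Qed.

Lemma inner_conj n (x y : 'cV[C]_n) : inner y x = (inner x y)^*.
Proof.
rewrite !inner_sum rmorph_sum; apply: eq_bigr => i _.
by rewrite rmorphM /= conjcK mulrC.
Qed.

Lemma innerDl n (x x' y : 'cV[C]_n) : inner (x + x') y = inner x y + inner x' y.
Proof. by rewrite !innerE mulmxDr mxE. Qed.

Lemma innerZl n a (x y : 'cV[C]_n) : inner (a *: x) y = a * inner x y.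
Proof. by rewrite !innerE -scalemxAr mxE. Qed.

Lemma innerZr n a (x y : 'cV[C]_n) : inner x (a *: y) = a^* * inner x y.
Proof. by rewrite !innerE tCZ -scalemxAl mxE. Qed.

Lemma inner_ge0 n (x : 'cV[C]_n) : 0 <= inner x x.
Proof.
by rewrite inner_sum; apply: sumr_ge0 => i _; rewrite mulrC mulcJ_ge0.
Qed.

Lemma inner_eq0 n (x : 'cV[C]_n) : inner x x = 0 -> x = 0.
Proof.
rewrite inner_sum => /eqP; rewrite psumr_eq0; last first.
  by move=> i _; rewrite mulrC mulcJ_ge0.
move=> /allP x0; apply/colP => i; rewrite mxE; apply/eqP.
have := x0 i (mem_index_enum i).
by rewrite /= mulf_eq0 conjc_eq0 orbb.
Qed.

(** The underlying real inner product. It is symmetric and real bilinear, and estimates for it pass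
    to the modulus of [inner] by a phase rotation. *)
Definition rinner n (x y : 'cV[C]_n) : R := complex.Re (inner x y).

Lemma rinnerDl n (x x' y : 'cV[C]_n) : rinner (x + x') y = rinner x y + rinner x' y.
Proof. by rewrite /rinner innerDl ReD. Qed.

Lemma rinnerC n (x y : 'cV[C]_n) : rinner x y = rinner y x.
Proof. by rewrite /rinner inner_conj Re_conj. Qed.

Lemma rinnerZl n (a : R) (x y : 'cV[C]_n) : rinner (a%:C *: x) y = a * rinner x y.
Proof. by rewrite /rinner innerZl ReZ. Qed.

Lemma rinner_adj m n (M : 'M[C]_(m, n)) x y :
  rinner (M *m x) y = rinner x (M^t* *m y).
Proof. by rewrite /rinner inner_adj. Qed.

Lemma sqr_enorm n (x : 'cV[C]_n) : enorm x ^+ 2 = rinner x x.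
Proof. by rewrite sqr_sqrtr //; have := inner_ge0 x; rewrite lecE => /andP[]. Qed.

Lemma enorm_ge0 n (x : 'cV[C]_n) : 0 <= enorm x.
Proof. exact: sqrtr_ge0. Qed.

Lemma inner_self n (x : 'cV[C]_n) : inner x x = (enorm x ^+ 2)%:C.
Proof. by rewrite sqr_enorm /rinner RRe_real // ger0_real ?inner_ge0. Qed.

Lemma enorm_eq0 n (x : 'cV[C]_n) : enorm x = 0 -> x = 0.
Proof. by move=> x0; apply: inner_eq0; rewrite inner_self x0 expr0n. Qed.

Lemma enorm0 n : enorm (0 : 'cV[C]_n) = 0.
Proof. by rewrite /enorm innerE mulmx0 mxE sqrtr0. Qed.

Lemma enorm_eq n m (x : 'cV[C]_n) (y : 'cV[C]_m) :
  inner x x = inner y y -> enorm x = enorm y.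
Proof. by rewrite /enorm => ->. Qed.

Lemma mulc_conj (a : C) : a * a^* = (complex.Re `|a| ^+ 2)%:C.
Proof.
case: a => a b; rewrite normc_def /= sqr_sqrtr ?addr_ge0 ?sqr_ge0 //.
by apply/eqP; rewrite eq_complex /=; apply/andP; split; apply/eqP; ring.
Qed.

Lemma enormZ n (a : C) (x : 'cV[C]_n) :
  enorm (a *: x) = complex.Re `|a| * enorm x.
Proof.
have a0 : 0 <= complex.Re `|a| by rewrite normc_def /= sqrtr_ge0.
apply: (pexpIrn (n:=2)) => //; rewrite ?nnegrE ?mulr_ge0 ?enorm_ge0 //.
apply: complexI; rewrite -inner_self innerZl innerZr exprMn rmorphM /= -inner_self.
by rewrite mulrA mulc_conj.
Qed.

Lemma enormZR n (a : R) (x : 'cV[C]_n) : 0 <= a -> enorm (a%:C *: x) = a * enorm x.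
Proof. by move=> a0; rewrite enormZ ger0_norm ?ler0c. Qed.

Lemma rinner_le n (x y : 'cV[C]_n) : rinner x y <= enorm x * enorm y.
Proof.
have [x0|x0] := eqVneq (enorm x) 0.
  by rewrite (enorm_eq0 x0) enorm0 mul0r /rinner innerE mulmx0 mxE.
have [y0|y0] := eqVneq (enorm y) 0.
  by rewrite rinnerC (enorm_eq0 y0) enorm0 mulr0 /rinner innerE mulmx0 mxE.
have xp : 0 < enorm x by rewrite lt_neqAle eq_sym x0 enorm_ge0.
have yp : 0 < enorm y by rewrite lt_neqAle eq_sym y0 enorm_ge0.
(* Expanding the square of the norm of [|y| x - |x| y] gives Cauchy-Schwarz times [|x| |y|]. *)
have := sqr_ge0 (enorm ((enorm y)%:C *: x + (- enorm x)%:C *: y)).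
rewrite sqr_enorm !(rinnerDl, rinnerZl) ![rinner _ (_ + _)]rinnerC.
rewrite !(rinnerDl, rinnerZl) -!sqr_enorm (rinnerC y x) => H.
rewrite -(ler_pM2l (mulr_gt0 xp yp)); move: H; clear.
by move: (enorm x) (enorm y) (rinner x y) => a b r; lra.
Qed.

Lemma phase_exists (z : C) : exists2 w : C, `|w| = 1 & w * z = `|z|.
Proof.
have [->|z0] := eqVneq z 0; first by exists 1; rewrite ?normr1 // mulr0 normr0.
exists (`|z| / z); first by rewrite normf_div normr_id divff ?normr_eq0.
by rewrite divfK.
Qed.

(** Multiplying [x] by a phase turns the inner product into its modulus, so the bound on real parts
    suffices. *)
Lemma norm_inner_le n (x y : 'cV[C]_n) :
  complex.Re `|inner x y| <= enorm x * enorm y.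
Proof.
have [w w1 <-] := phase_exists (inner x y).
have := rinner_le (w *: x) y; rewrite /rinner innerZl => /le_trans; apply.
by rewrite enormZ w1 mul1r.
Qed.

Lemma Re_le_norm (z : C) : complex.Re z <= complex.Re `|z|.
Proof.
rewrite normc_def /= (le_trans (ler_norm _)) // -sqrtr_sqr ler_wsqrtr //.
by rewrite lerDl sqr_ge0.
Qed.

(* The spectral theorem gives the maximum as an eigenvalue, without a
   compactness argument. *)
Lemma normal_form_max n (H : 'M[C]_n) : (0 < n)%N -> H \is normalmx ->
  exists2 x : 'cV[C]_n, enorm x = 1 &
    forall z, rinner (H *m z) z <= rinner (H *m x) x * enorm z ^+ 2.
Proof.
move=> n0 /orthomx_spectralP [].
set P := spectralmx H; set d := spectral_diag H => [] [].
have Pu : P \is unitarymx by apply: spectral_unitarymx.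
rewrite invmx_unitary // => HE.
have PP : P *m P^t* = 1%:M by apply/unitarymxP.
have PP' : P^t* *m P = 1%:M by rewrite (mulmx1C PP).
(* In an orthonormal eigenbasis the form is the sum of the real parts of the eigenvalues, weighted
   by the squared moduli of the coordinates. *)
have E z : rinner (H *m z) z =
    \sum_i complex.Re (d 0 i) * complex.Re ((P *m z) i 0 * conjc ((P *m z) i 0)).
  rewrite HE -!mulmxA rinner_adj trmxCK /rinner inner_sum Re_sum.
  apply: eq_bigr => i _; rewrite -Re_mul_real ?mulcJ_ge0 //.
  by move: (P *m z) => w; rewrite mul_diag_mx mxE mulrCA [w i 0 * _]mulrC.
have N z : enorm z ^+ 2 = \sum_i complex.Re ((P *m z) i 0 * conjc ((P *m z) i 0)).
  have -> : enorm z ^+ 2 = enorm (P *m z) ^+ 2.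
    by rewrite [LHS]sqr_enorm [RHS]sqr_enorm [RHS](rinner_adj P) mulmxA PP' mul1mx.
  rewrite sqr_enorm /rinner inner_sum Re_sum.
  by apply: eq_bigr => i _; rewrite mulrC.
have [i0 _ Hi0] := arg_maxP (fun i => complex.Re (d 0 i)) (erefl (xpredT (Ordinal n0))).
(* A unit eigenvector for the eigenvalue with largest real part. *)
pose x : 'cV[C]_n := P^t* *m delta_mx i0 0.
have Px : P *m x = delta_mx i0 0 by rewrite mulmxA PP mul1mx.
have x1 : enorm x ^+ 2 = 1.
  rewrite N Px (bigD1 i0) //= big1 ?addr0; first by rewrite mxE !eqxx conjc1 mulr1.
  by move=> i ni; rewrite mxE (negbTE ni) mul0r.
exists x.
  by apply/eqP; rewrite -(@pexpr_eq1 _ _ 2) ?enorm_ge0 // x1.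
move=> z; have -> : rinner (H *m x) x = complex.Re (d 0 i0).
  rewrite E Px (bigD1 i0) //= big1 ?addr0.
    by rewrite mxE !eqxx conjc1 mulr1 mulr1.
  by move=> i ni; rewrite mxE (negbTE ni) mul0r mulr0.
rewrite E N mulr_sumr; apply: ler_sum => i _; apply: ler_wpM2r; last exact: Hi0.
by have := mulcJ_ge0 ((P *m z) i 0); rewrite lecE => /andP[].
Qed.

Lemma selfadj_normal n (H : 'M[C]_n) : H^t* = H -> H \is normalmx.
Proof. by move=> HH; apply/normalmxP; rewrite HH. Qed.

(** The bound comes from the largest eigenvalue of [M^t* *m M]. It makes the sets defining [opnorm]
    and [numradius] bounded, so that their suprema are meaningful. *)
Lemma enorm_mul_bound m n (M : 'M[C]_(m, n)) :
  exists2 c, 0 <= c & forall x, enorm (M *m x) <= c * enorm x.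
Proof.
case: n M => [|n] M.
  by exists 0 => // x; rewrite [x]flatmx0 mulmx0 enorm0 mul0r.
have [|y y1 Hy] := @normal_form_max _ (M^t* *m M) isT.
  by apply: selfadj_normal; rewrite tC_mul trmxCK.
have E z : rinner (M^t* *m M *m z) z = enorm (M *m z) ^+ 2.
  by rewrite -mulmxA rinner_adj trmxCK sqr_enorm.
exists (enorm (M *m y)); first exact: enorm_ge0.
move=> x; rewrite -(@ler_pXn2r _ 2) ?nnegrE ?mulr_ge0 ?enorm_ge0 //.
by have := Hy x; rewrite [X in X <= _]E [X in _ <= X * _]E -exprMn.
Qed.

End InnerProduct.

(** * Operator norm and numerical radius *)

Section Norms.
Variable R : realType.
Implicit Types m n p : nat.
Local Notation C := R[i].

Lemma enorm_gt0 n (x : 'cV[C]_n) : x != 0 -> 0 < enorm x.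
Proof.
move=> x0; rewrite lt_neqAle enorm_ge0 andbT eq_sym.
by apply: contra x0 => /eqP/enorm_eq0 ->.
Qed.

Lemma enorm_normalize n (x : 'cV[C]_n) : x != 0 ->
  enorm ((enorm x)^-1%:C *: x) = 1.
Proof.
move=> /enorm_gt0 x0; rewrite enormZR ?invr_ge0 ?(ltW x0) //.
by rewrite mulVf ?gt_eqF.
Qed.

Section OpNorm.
Variables (m n : nat) (M : 'M[C]_(m, n)).

Let has_ubound_ball :
  has_ubound [set enorm (M *m x) | x in [set x : 'cV[C]_n | enorm x <= 1]]%classic.
Proof.
have [c c0 Hc] := enorm_mul_bound M; exists c => _ [x /= x1 <-].
by apply: le_trans (Hc x) _; rewrite -[leRHS]mulr1 ler_wpM2l.
Qed.

Lemma opnorm_ge0 : 0 <= opnorm M.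
Proof.
apply: le_trans (ub_le_sup has_ubound_ball _); first exact: (enorm_ge0 (M *m 0)).
by exists 0 => //=; rewrite enorm0 ler01.
Qed.

Lemma enorm_mul_le (x : 'cV[C]_n) : enorm (M *m x) <= opnorm M * enorm x.
Proof.
have [->|x0] := eqVneq x 0; first by rewrite mulmx0 !enorm0 mulr0.
have xp := enorm_gt0 x0.
rewrite -ler_pdivrMr // mulrC -enormZR ?invr_ge0 ?(ltW xp) // scalemxAr.
apply: (ub_le_sup has_ubound_ball).
by exists ((enorm x)^-1%:C *: x); rewrite //= enorm_normalize.
Qed.

Lemma opnorm_gt0 : M <> 0 -> 0 < opnorm M.
Proof.
move=> M0; rewrite lt_neqAle opnorm_ge0 andbT; apply/eqP => M1; apply: M0.
apply/matrixP => i j; rewrite [RHS]mxE.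
have : enorm (M *m delta_mx j 0) = 0.
  apply/le_anti; rewrite enorm_ge0 andbT.
  by apply: le_trans (enorm_mul_le _) _; rewrite -M1 mul0r.
move/enorm_eq0 => /colP/(_ i); rewrite [RHS]mxE => <-.
rewrite mxE (bigD1 j) //= big1 ?addr0 ?mxE ?eqxx ?mulr1 // => l lj.
by rewrite mxE (negbTE lj) mulr0.
Qed.

Lemma rinner_mul_le (x : 'cV[C]_n) (y : 'cV[C]_m) :
  rinner (M *m x) y <= opnorm M * enorm x * enorm y.
Proof.
apply: le_trans (rinner_le _ _) _.
by apply: ler_wpM2r; [exact: enorm_ge0 | exact: enorm_mul_le].
Qed.

(** The squared norm of [z = M^t* *m y] equals [rinner (M *m z) y], and one factor [enorm z]
    cancels. *)
Lemma enorm_adj_mul_le (y : 'cV[C]_m) : enorm (M^t* *m y) <= opnorm M * enorm y.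
Proof.
have [->|z0] := eqVneq (M^t* *m y) 0.
  by rewrite enorm0 mulr_ge0 ?opnorm_ge0 ?enorm_ge0.
rewrite -(ler_pM2r (enorm_gt0 z0)) -expr2 sqr_enorm -rinner_adj mulrAC.
exact: rinner_mul_le.
Qed.

(** The equality case of Cauchy-Schwarz: the squared norm of [M x - a y] is [|M x|^2 - 2 a^2 + a^2],
    which is at most 0. *)
Lemma mulmx_eq_of_rinner_max (a : R) (x : 'cV[C]_n) (y : 'cV[C]_m) :
    enorm x = 1 -> enorm y = 1 -> enorm (M *m x) <= a -> rinner (M *m x) y = a ->
  M *m x = a%:C *: y.
Proof.
move=> x1 y1 Ma Mxy; apply/eqP; rewrite -subr_eq0; apply/eqP/enorm_eq0.
apply/eqP; rewrite -sqrf_eq0 eq_le sqr_ge0 andbT.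
have -> : M *m x - a%:C *: y = M *m x + (- a)%:C *: y.
  by rewrite rmorphN scaleNr.
set z := M *m x in Ma Mxy *.
rewrite sqr_enorm !(rinnerDl, rinnerZl) ![rinner _ (_ + _)]rinnerC.
rewrite !(rinnerDl, rinnerZl) -(sqr_enorm z) -(sqr_enorm y) (rinnerC y z) Mxy y1.
have : enorm z ^+ 2 <= a ^+ 2 by rewrite lerXn2r ?nnegrE ?(le_trans _ Ma) ?enorm_ge0.
by rewrite -subr_le0; apply: le_trans; rewrite le_eqVlt; apply/orP; left; apply/eqP; ring.
Qed.

End OpNorm.

Section NumRadius.
Variables (n : nat) (B : 'M[C]_n).

(** The condition [0 <= c] covers dimension 0, where the unit sphere is empty and the supremum is 0
    by convention. *)
Lemma numradius_le c : 0 <= c ->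
  (forall x, enorm x = 1 -> complex.Re `|inner (B *m x) x| <= c) ->
  numradius B <= c.
Proof.
move=> c0 Hc; rewrite /numradius.
set E := (X in sup X); have [[z Ez]|/set0P/negP] := pselect (E !=set0)%classic.
  apply: ge_sup; first by exists z.
  by move=> _ [x /= x1 <-]; apply: Hc.
by rewrite negbK => /eqP ->; rewrite sup0.
Qed.

Lemma norm_form_le_numradius (x : 'cV[C]_n) : enorm x = 1 ->
  complex.Re `|inner (B *m x) x| <= numradius B.
Proof.
move=> x1; apply: ub_le_sup; last by exists x.
have [c c0 Hc] := enorm_mul_bound B; exists c => _ [y /= y1 <-].
apply: le_trans (norm_inner_le _ _) _.
by rewrite y1 mulr1 (le_trans (Hc y)) // y1 mulr1.
Qed.

Lemma rinner_le_numradius (x : 'cV[C]_n) :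
  rinner (B *m x) x <= numradius B * enorm x ^+ 2.
Proof.
have [->|x0] := eqVneq x 0.
  by rewrite mulmx0 enorm0 expr0n mulr0 /rinner innerE mulmx0 mxE.
have xp := enorm_gt0 x0.
have := norm_form_le_numradius (enorm_normalize x0).
move=> /(le_trans (Re_le_norm _)); rewrite -/(rinner _ _).
rewrite -scalemxAr rinnerZl rinnerC rinnerZl rinnerC mulrA -expr2 exprVn.
by rewrite mulrC ler_pdivrMr // exprn_gt0.
Qed.

Lemma numradius_ge0 : 0 <= numradius B.
Proof.
rewrite /numradius; set E := (X in sup X).
have [[z Ez]|/set0P/negP] := pselect (E !=set0)%classic.
  case: Ez => x /= x1 _; apply: le_trans (norm_form_le_numradius x1).
  by rewrite normc_def /= sqrtr_ge0.
by rewrite negbK => /eqP ->; rewrite sup0.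
Qed.

End NumRadius.

(** [V] is an isometry, so the values of the compressed form on unit vectors [x] are values of the
    form of [B] at the unit vectors [V x]. *)
Lemma numradius_compression n p (B : 'M[C]_n) (V : 'M[C]_(n, p)) :
  V^t* *m V = 1%:M -> numradius (V^t* *m B *m V) <= numradius B.
Proof.
move=> VV; apply: numradius_le => [|x x1]; first exact: numradius_ge0.
rewrite -!mulmxA inner_adj trmxCK; apply: norm_form_le_numradius.
rewrite -x1; apply: enorm_eq.
by rewrite inner_adj mulmxA VV mul1mx.
Qed.

End Norms.

(** * Block shifts, attainment of their numerical radius, and part (a) *)

Section Blocks.
Variable R : realType.
Local Notation C := R[i].
Variables (k : nat) (n : 'I_k -> nat).

Lemma tC_mxcol q (B : forall i, 'M[C]_(n i, q)) :
  (\mxcol_i B i)^t* = \mxrow_i (B i)^t*.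
Proof. by rewrite tr_mxcol; apply/matrixP => i j; rewrite !mxE. Qed.

Lemma inner_mxcol (x y : forall i, 'cV[C]_(n i)) :
  inner (\mxcol_i x i) (\mxcol_i y i) = \sum_i inner (x i) (y i).
Proof.
rewrite innerE tC_mxcol mul_mxrow_mxcol summxE.
by apply: eq_bigr => i _; rewrite innerE.
Qed.

Lemma sqr_enorm_mxcol (x : forall i, 'cV[C]_(n i)) :
  enorm (\mxcol_i x i) ^+ 2 = \sum_i enorm (x i) ^+ 2.
Proof.
rewrite sqr_enorm /rinner inner_mxcol Re_sum.
by apply: eq_bigr => i _; rewrite sqr_enorm.
Qed.

Variable A : forall i j : 'I_k, 'M[C]_(n i, n j).

Lemma blockshift_mul q (x : forall i, 'M[C]_(n i, q)) :
  blockshift A *m \mxcol_i x i =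
  \mxcol_(i < k) (\sum_(j : 'I_k | j == i.+1 :> nat) A i j *m x j).
Proof.
rewrite mul_mxblock_mxrow; apply: eq_mxcol => i.
by rewrite [RHS]big_mkcond /=; apply: eq_bigr => j _; case: ifP => // _; rewrite mul0mx.
Qed.

Lemma inner_blockshift (x : forall i, 'cV[C]_(n i)) :
  inner (blockshift A *m \mxcol_i x i) (\mxcol_i x i) =
  \sum_(i < k) \sum_(j : 'I_k | j == i.+1 :> nat) inner (A i j *m x j) (x i).
Proof.
rewrite blockshift_mul inner_mxcol; apply: eq_bigr => i _.
by elim/big_rec2: _ => [|j a b _ <-]; rewrite ?innerDl // innerE mulmx0 mxE.
Qed.

Lemma rinner_blockshift (x : forall i, 'cV[C]_(n i)) :
  rinner (blockshift A *m \mxcol_i x i) (\mxcol_i x i) =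
  \sum_(i < k) \sum_(j : 'I_k | j == i.+1 :> nat) rinner (A i j *m x j) (x i).
Proof.
rewrite /rinner inner_blockshift Re_sum; apply: eq_bigr => i _.
by rewrite Re_sum.
Qed.

(* The diagonal unitary with blocks w^j conjugates the block shift into its
   multiple by w. *)
Lemma blockshift_rotate (w : C) (z : 'cV[C]_(\sum_(i < k) n i)) : `|w| = 1 ->
  exists2 z', enorm z' = enorm z &
    inner (blockshift A *m z') z' = w * inner (blockshift A *m z) z.
Proof.
move=> w1; have ww : w * w^* = 1 by rewrite -(normCK w) w1 expr1n.
pose x i := submxcol z i.
have zE : z = \mxcol_i x i by rewrite submxcolK.
exists (\mxcol_i (w ^+ i *: x i)).
  rewrite zE; apply: enorm_eq; rewrite !inner_mxcol; apply: eq_bigr => i _.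
  by rewrite innerZl innerZr rmorphXn mulrA -exprMn ww expr1n mul1r.
rewrite zE !inner_blockshift mulr_sumr; apply: eq_bigr => i _.
rewrite mulr_sumr; apply: eq_bigr => j /eqP ->.
rewrite -scalemxAr innerZl innerZr rmorphXn mulrA exprS -(mulrA w).
by rewrite -exprMn ww expr1n mulr1.
Qed.

(** A unit vector maximizing the form of the self-adjoint [B + B^t*] maximizes the real part of the
    form of [B]. Rotation invariance then shows that this maximum also bounds the modulus. *)
Lemma numradius_blockshift_attained : (0 < \sum_(i < k) n i)%N ->
  exists2 x, enorm x = 1 & rinner (blockshift A *m x) x = numradius (blockshift A).
Proof.
move=> n0; set B := blockshift A.
have [|x x1 Hx] := @normal_form_max _ _ (B + B^t*) n0.
  by apply: selfadj_normal; rewrite tCD trmxCK addrC.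
have E z : rinner ((B + B^t*) *m z) z = 2 * rinner (B *m z) z.
  by rewrite mulmxDl rinnerDl (rinner_adj (B^t*)) trmxCK (rinnerC z) mulr_natl mulr2n.
exists x => //; apply/le_anti/andP; split.
  by have := rinner_le_numradius B x; rewrite x1 expr1n mulr1.
have Hx' z : enorm z = 1 -> rinner (B *m z) z <= rinner (B *m x) x.
  by move=> z1; have := Hx z; rewrite !E z1 expr1n mulr1 ler_pM2l ?ltr0n.
have key z : enorm z = 1 ->
    complex.Re `|inner (B *m z) z| <= rinner (B *m x) x.
  (* The phase [w] makes the value real and nonnegative, and the rotated unit vector [z'] realizes
     it, so the bound on real parts applies at [z']. *)
  move=> z1; have [w w1 <-] := phase_exists (inner (B *m z) z).
  have [z' z'1 <-] := blockshift_rotate z w1.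
  by apply: Hx'; rewrite z'1.
apply: numradius_le => //.
by apply: le_trans (key x x1); rewrite normc_def /= sqrtr_ge0.
Qed.

(** The left side is the form of [normshift A] at the real vector [y]. It is applied with [y i] the
    norm of the block [i] of a vector. *)
Lemma normshift_form (y : 'I_k -> R) :
  \sum_(i < k) \sum_(j : 'I_k | j == i.+1 :> nat) opnorm (A i j) * y j * y i
  <= numradius (normshift A) * \sum_i y i ^+ 2.
Proof.
pose Y : 'cV[C]_k := \col_i (y i)%:C.
have YE : enorm Y ^+ 2 = \sum_i y i ^+ 2.
  rewrite sqr_enorm /rinner inner_sum Re_sum; apply: eq_bigr => i _.
  by rewrite !mxE /= mulr0 subr0.
have <- : rinner (normshift A *m Y) Y =
    \sum_(i < k) \sum_(j : 'I_k | j == i.+1 :> nat) opnorm (A i j) * y j * y i.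
  rewrite /rinner inner_sum Re_sum; apply: eq_bigr => i _.
  rewrite !mxE [X in complex.Re (X * _)](conjc_real (y i)) ReZ Re_sum.
  rewrite mulrC big_distrl [RHS]big_mkcond /=.
  apply: eq_bigr => j _; rewrite !mxE; case: ifP => _; last by rewrite mul0r /= mul0r.
  by rewrite ReZ.
by rewrite -YE; apply: rinner_le_numradius.
Qed.

Lemma rinner_blockshift_le (x : forall i, 'cV[C]_(n i)) :
  rinner (blockshift A *m \mxcol_i x i) (\mxcol_i x i) <=
  \sum_(i < k) \sum_(j : 'I_k | j == i.+1 :> nat)
    opnorm (A i j) * enorm (x j) * enorm (x i).
Proof.
rewrite rinner_blockshift; apply: ler_sum => i _; apply: ler_sum => j _.
exact: rinner_mul_le.
Qed.

Lemma numradius_blockshift_le : (0 < \sum_(i < k) n i)%N ->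
  numradius (blockshift A) <= numradius (normshift A).
Proof.
move=> /numradius_blockshift_attained [x x1 <-].
have xE : x = \mxcol_i (submxcol x i) by rewrite submxcolK.
move: x1; rewrite xE => x1.
apply: le_trans (rinner_blockshift_le _) _.
apply: le_trans (normshift_form _) _.
by rewrite -sqr_enorm_mxcol x1 expr1n mulr1.
Qed.

End Blocks.

(** * The equality case: termwise equality and positivity of the maximizer *)

Lemma eq_of_eq_sum (R : numDomainType) (I : finType) (P : pred I) (F G : I -> R) :
    (forall i, P i -> F i <= G i) -> \sum_(i | P i) F i = \sum_(i | P i) G i ->
  forall i, P i -> F i = G i.
Proof.
move=> FG /eqP; rewrite eq_sym -subr_eq0 -sumrB psumr_eq0 => [|i Pi]; last first.
  by rewrite subr_ge0 FG.
move=> /allP E i Pi; have := E i (mem_index_enum i); rewrite Pi /= subr_eq0.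
by move=> /eqP.
Qed.

(** Perron-Frobenius for a path: a zero entry of a nonnegative maximizer forces its neighbours to
    vanish, hence all entries, against the unit norm. *)
Lemma positive_maximizer (R : realFieldType) (k : nat) (c : 'I_k -> 'I_k -> R)
    (w : R) (y : 'I_k -> R) :
    let Q z := \sum_(i < k) \sum_(j : 'I_k | j == i.+1 :> nat) c i j * z j * z i in
    (forall i j : 'I_k, j = i.+1 :> nat -> 0 < c i j) ->
    (forall i, 0 <= y i) -> \sum_i y i ^+ 2 = 1 -> Q y = w ->
    (forall z, Q z <= w * \sum_i z i ^+ 2) ->
  forall i, 0 < y i.
Proof.
move=> Q c0 y0 y1 Qy Qw.
have QE z : Q z = \sum_(p : 'I_k * 'I_k | p.2 == p.1.+1 :> nat) c p.1 p.2 * z p.2 * z p.1.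
  by rewrite /Q pair_big_dep.
have w0 : 0 <= w.
  rewrite -Qy QE; apply: sumr_ge0 => p /eqP /c0 /ltW cp.
  by rewrite !mulr_ge0.
(* Raising a zero entry of [y] by [t] costs [w t^2] but gains a multiple of [t]
   as soon as a neighbour is positive. *)
have step (p : 'I_k * 'I_k) (l o : 'I_k) : p.2 = p.1.+1 :> nat -> l != o ->
    (forall z : 'I_k -> R, z p.2 * z p.1 = z l * z o) -> y l = 0 -> y o = 0.
  move=> pE lo zE yl; apply/le_anti; rewrite y0 andbT leNgt; apply/negP => yo.
  have cp := c0 _ _ pE; set a := c p.1 p.2 * y o.
  have a0 : 0 < a by rewrite mulr_gt0.
  (* With this choice [w * t < a], so the gain [a * t] exceeds the cost [w * t ^+ 2]. *)
  pose t := a / (w + 1).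
  have wp : 0 < w + 1 by rewrite ltr_wpDl.
  have t0 : 0 < t by rewrite divr_gt0.
  pose z i := if i == l then t else y i.
  have zl : z l = t by rewrite /z eqxx.
  have zo : z o = y o by rewrite /z eq_sym (negbTE lo).
  have z2 : \sum_i z i ^+ 2 = 1 + t ^+ 2.
    rewrite -y1 (bigD1 l) //= [in RHS](bigD1 l) //= yl expr0n add0r addrC.
    rewrite zl; congr (_ + _); apply: eq_bigr => i /negbTE il.
    by rewrite /z il.
  have yz i : y i <= z i by rewrite /z; case: eqP => // ->; rewrite yl ltW.
  (* The term of the edge [p] rises from 0 to [a * t]; the other terms do not decrease, since
     [y i <= z i]. *)
  have : w + a * t <= Q z.
    rewrite -Qy !QE (bigD1 p) ?pE //= [leRHS](bigD1 p) ?pE //=.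
    rewrite -!mulrA !zE yl mul0r mulr0 add0r addrC.
    rewrite zl zo (mulrC t) lerD2r.
    apply: ler_sum => q /andP[/eqP/c0/ltW cq _].
    by rewrite -!mulrA ler_wpM2l // ler_pM.
  move=> /le_trans /(_ (Qw z)); rewrite z2 mulrDr mulr1 lerD2l expr2 mulrA ler_pM2r //.
  rewrite /t mulrA ler_pdivlMr // mulrDr mulr1 [w * a]mulrC gerDl.
  by rewrite leNgt a0.
have adj (i j : 'I_k) : j = i.+1 :> nat -> y i = 0 <-> y j = 0.
  move=> ij; have nij : i != j by rewrite -val_eqE /= ij neq_ltn ltnSn.
  split.
    by apply: (step (i, j)) => // z; rewrite mulrC.
  by apply: (step (i, j)) => //; rewrite eq_sym.
move=> i; rewrite lt_neqAle y0 andbT; apply/eqP => /esym yi.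
have k0 : (0 < k)%N by case: i {yi}; case: (k).
have all0 m (hm : (m < k)%N) : y (Ordinal hm) = 0 <-> y (Ordinal k0) = 0.
  elim: m hm => [|m IH] hm; first by rewrite (bool_irrelevance hm k0).
  by rewrite -(IH (ltnW hm)); apply: iff_sym; apply: adj.
have y_0 i' : y i' = 0.
  case: i' => m hm; apply/all0; apply/(all0 i (ltn_ord i)).
  by rewrite -[RHS]yi; congr y; apply: val_inj.
move: y1; rewrite big1 => [|j _]; last by rewrite y_0 expr0n.
by move/eqP; rewrite eq_sym oner_eq0.
Qed.

(** * Splitting off the norm shift by a reducing subspace *)

Section Reducing.
Variable R : realType.
Local Notation C := R[i].

(** Gram-Schmidt completes [v] to an orthonormal basis; the columns of [W] are the added vectors. *)
Lemma unit_vector_complement n (v : 'cV[C]_n) : enorm v = 1 ->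
  exists W : 'M[C]_(n, n.-1),
    [/\ W^t* *m W = 1%:M, W^t* *m v = 0 & v *m v^t* + W *m W^t* = 1%:M].
Proof.
case: n v => [|n] v v1.
  by move: v1; rewrite [v]flatmx0 enorm0 => /eqP; rewrite eq_sym oner_eq0.
(* Only the first row carries data; [schmidt] replaces the zero rows by a unitary completion. *)
pose D : 'M[C]_(1 + n, 1 + n) := col_mx (v^t*) 0.
pose S : 'M[C]_(1 + n, 1 + n) := schmidt D.
have SS : S *m S^t* = 1%:M by apply/unitarymxP/schmidt_unitarymx.
have SS' : S^t* *m S = 1%:M by apply: mulmx1C.
pose s : 'rV[C]_(1 + n) := usubmx S; pose T : 'M[C]_(n, 1 + n) := dsubmx S.
have SE : S = col_mx s T by rewrite vsubmxK.
have StE : S^t* = row_mx (s^t*) (T^t*) by rewrite SE tr_col_mx map_row_mx.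
move: SS; rewrite SE -SE StE {1}SE mul_col_row [RHS]scalar_mx_block.
move=> /eq_block_mx[ss _ Ts TT].
move: SS'; rewrite StE SE mul_row_col => sT.
(* The first row of [D] lies in the span of the first row of [S], so [s] agrees with [v^t*] up to a
   scalar, which is a phase because both are unit vectors. *)
have [a va] : exists a, v^t* = a *: s.
  apply/sub_rVP; have := row_schmidt_sub D 0.
  rewrite (big_pred1 0) => [|i]; last by rewrite leqn0.
  rewrite genmxE.
  have -> : row 0 D = v^t*.
    by apply/rowP => j; rewrite !mxE; case: splitP => // i; rewrite !ord1 !mxE.
  have -> : row 0 (schmidt D) = s.
    by apply/rowP => j; rewrite !mxE; congr (schmidt D _ _); apply: val_inj.
  by [].
have vE : v = a^* *: s^t* by rewrite -tCZ -va trmxCK.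
have aa : a^* * a = 1.
  have : inner v v = 1 by rewrite inner_self v1 expr1n.
  rewrite innerE va vE -scalemxAr -scalemxAl ss scalerA => <-.
  by rewrite !mxE eqxx mulr1.
exists (T^t*); rewrite trmxCK; split=> //.
  by rewrite vE -scalemxAr Ts scaler0.
rewrite va [in X in X *m _]vE -scalemxAl -scalemxAr scalerA aa scale1r.
exact: sT.
Qed.

(** Needed because the two sizes are equal only propositionally; the equality is eliminated to reach
    square matrices. *)
Lemma mulmx1_sym p q (M : 'M[C]_(p, q)) (N : 'M[C]_(q, p)) :
  q = p -> N *m M = 1%:M -> M *m N = 1%:M.
Proof. by move=> qp; case: p / qp M N => M N; apply: mulmx1C. Qed.

Section ReducingBlocks.
Variables (k : nat) (n : 'I_k -> nat).
Variable A : forall i j : 'I_k, 'M[C]_(n i, n j).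

Lemma numradius_eq_reducing_vectors : (0 < \sum_(i < k) n i)%N ->
    (forall i j : 'I_k, j = i.+1 :> nat -> A i j <> 0) ->
    numradius (blockshift A) = numradius (normshift A) ->
  exists v : forall i, 'cV[C]_(n i), (forall i, enorm (v i) = 1) /\
    forall i j : 'I_k, j = i.+1 :> nat ->
      A i j *m v j = (opnorm (A i j))%:C *: v i /\
      (A i j)^t* *m v i = (opnorm (A i j))%:C *: v j.
Proof.
move=> n0 A0 Aeq.
have [x x1 xw] := numradius_blockshift_attained A n0.
pose b i := submxcol x i; pose y i := enorm (b i).
have xE : x = \mxcol_i b i by rewrite submxcolK.
have y1 : \sum_i y i ^+ 2 = 1 by rewrite -sqr_enorm_mxcol -xE x1 expr1n.
move: xw; rewrite Aeq xE => xw.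
have Q2 := normshift_form A y; rewrite y1 mulr1 in Q2.
(* The middle of the chain [<Ax,x> <= Q(y) <= w(A')] is squeezed, since both ends equal [w(A')]. *)
have Qw : \sum_(i < k) \sum_(j : 'I_k | j == i.+1 :> nat) opnorm (A i j) * y j * y i
    = numradius (normshift A).
  by apply/le_anti; rewrite Q2 -xw; apply: rinner_blockshift_le.
have yp i : 0 < y i.
  apply: (positive_maximizer _ _ y1 Qw (normshift_form A)) => [i' j ij|i'].
    exact/opnorm_gt0/A0.
  exact: enorm_ge0.
have eqt (i j : 'I_k) : j = i.+1 :> nat ->
    rinner (A i j *m b j) (b i) = opnorm (A i j) * y j * y i.
  move=> /eqP ij; move: xw; rewrite -Qw rinner_blockshift => E.
  (* Equality of the double sums gives equality of the inner sums, then of each term. *)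
  apply: (eq_of_eq_sum (P := fun j : 'I_k => j == i.+1 :> nat)
    (F := fun j => rinner (A i j *m b j) (b i))
    (G := fun j => opnorm (A i j) * y j * y i)) => //.
    by move=> *; apply: rinner_mul_le.
  apply: (eq_of_eq_sum (P := xpredT) _ E) => // i' _.
  by apply: ler_sum => *; apply: rinner_mul_le.
pose v i := (y i)^-1%:C *: b i.
have v1 i : enorm (v i) = 1.
  by rewrite /v enormZR ?invr_ge0 ?(ltW (yp i)) // mulVf ?gt_eqF.
exists v; split=> // i j ij.
have rv : rinner (A i j *m v j) (v i) = opnorm (A i j).
  rewrite /v -scalemxAr rinnerZl rinnerC rinnerZl rinnerC eqt //.
  by have := yp i; have := yp j => *; field; rewrite !gt_eqF.
split.
  by apply: mulmx_eq_of_rinner_max => //; rewrite -[leRHS]mulr1 -(v1 j) enorm_mul_le.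
apply: mulmx_eq_of_rinner_max => //.
  by rewrite -[leRHS]mulr1 -(v1 i) enorm_adj_mul_le.
by rewrite rinner_adj trmxCK rinnerC.
Qed.

(** The columns of [V] are the [v i], and [Z] is block diagonal with blocks [W i]. Then [[V Z]] is
    unitary and intertwines the block shift with the direct sum. The blocks of [B] may have size 0,
    namely where [n i = 1]. *)
Lemma blockshift_decomposition (v : forall i, 'cV[C]_(n i)) :
    (forall i, (1 <= n i)%N) -> (forall i, enorm (v i) = 1) ->
    (forall i j : 'I_k, j = i.+1 :> nat ->
      A i j *m v j = (opnorm (A i j))%:C *: v i /\
      (A i j)^t* *m v i = (opnorm (A i j))%:C *: v j) ->
  exists B : forall i j : 'I_k, 'M[C]_((n i).-1, (n j).-1),
    numradius (blockshift B) <= numradius (blockshift A) /\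
    unitarily_similar (blockshift A) (dirsum (normshift A) (blockshift B)).
Proof.
move=> n1 v1 Av.
pose W i : 'M[C]_(n i, (n i).-1) := sval (cid (unit_vector_complement (v1 i))).
have WP i : [/\ (W i)^t* *m W i = 1%:M, (W i)^t* *m v i = 0
    & v i *m (v i)^t* + W i *m (W i)^t* = 1%:M].
  exact: (svalP (cid (unit_vector_complement (v1 i)))).
have vv i : (v i)^t* *m v i = 1%:M.
  apply/matrixP => a b; rewrite !ord1 -innerE inner_self v1 expr1n.
  by rewrite mxE.
have vW i : (v i)^t* *m W i = 0.
  by have [_ Wv _] := WP i; rewrite -[W i]trmxCK -tC_mul Wv trmx0 map_mx0.
pose B i j := (W i)^t* *m A i j *m W j.
(* Block row [i] of the identity, so that [W i *m S i] is block row [i] of a block diagonal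
   matrix. *)
pose S i : 'M[C]_((n i).-1, \sum_i (n i).-1) := submxcol 1%:M i.
have SE : \mxcol_i S i = 1%:M by apply: submxcolK.
pose V : 'M[C]_(\sum_i n i, k) := \mxcol_i (v i *m delta_mx 0 i).
pose Z : 'M[C]_(\sum_i n i, \sum_i (n i).-1) := \mxcol_i (W i *m S i).
have VV : V^t* *m V = 1%:M.
  rewrite tC_mxcol mul_mxrow_mxcol mx1_sum_delta; apply: eq_bigr => i _.
  rewrite tC_mul -mulmxA (mulmxA _ (v i)) vv mul1mx trmx_delta map_delta_mx.
  by rewrite mul_delta_mx.
have VZ : V^t* *m Z = 0.
  rewrite tC_mxcol mul_mxrow_mxcol; apply: big1 => i _.
  rewrite tC_mul -mulmxA (mulmxA _ (W i)).
  by rewrite vW mul0mx mulmx0.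
have ZV : Z^t* *m V = 0 by rewrite -[V]trmxCK -tC_mul VZ trmx0 map_mx0.
have ZZ : Z^t* *m Z = 1%:M.
  rewrite tC_mxcol mul_mxrow_mxcol -[RHS]mulmx1 -{2}SE.
  have -> : 1%:M = (\mxcol_i S i)^t* by rewrite SE trmx1 map_mx1.
  rewrite tC_mxcol mul_mxrow_mxcol; apply: eq_bigr => i _.
  have [WW _ _] := WP i.
  by rewrite tC_mul -mulmxA (mulmxA _ (W i)) WW mul1mx.
have AV : blockshift A *m V = V *m normshift A.
  rewrite blockshift_mul mxcol_mul; apply: eq_mxcol => i.
  rewrite -mulmxA -rowE (row_sum_delta (row i _)) mulmx_sumr.
  rewrite [LHS]big_mkcond; apply: eq_bigr => j _.
  rewrite !mxE -scalemxAr; case: eqP => [/Av[AvE _]|_]; last by rewrite scale0r.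
  by rewrite mulmxA AvE -scalemxAl.
have SB i : S i *m blockshift B = \sum_(j : 'I_k | j == i.+1 :> nat) B i j *m S j.
  by rewrite submxcol_mul mul1mx -[blockshift B]mulmx1 -SE blockshift_mul mxcolK.
have AZ : blockshift A *m Z = Z *m blockshift B.
  rewrite blockshift_mul mxcol_mul; apply: eq_mxcol => i.
  rewrite -mulmxA SB mulmx_sumr; apply: eq_bigr => j /eqP /Av[_ AvE].
  rewrite /B !mulmxA; congr (_ *m _).
  (* The adjoint relation for [v i] turns the left side into a multiple of [(v j)^t* *m W j], which
     is 0. Hence [A i j] maps the complement of [v j] into that of [v i]. *)
  have vAW : (v i)^t* *m A i j *m W j = 0.
    by rewrite -[A i j]trmxCK -tC_mul AvE tCZ -scalemxAl vW scaler0.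
  have [_ _ vvWW] := WP i.
  rewrite -[LHS]mul1mx -vvWW mulmxDl -(mulmxA (v i)) [X in v i *m X]mulmxA vAW.
  by rewrite mulmx0 add0r !mulmxA.
exists B; split.
  have -> : blockshift B = Z^t* *m blockshift A *m Z.
    by rewrite -mulmxA AZ mulmxA ZZ mul1mx.
  exact: numradius_compression.
pose U := row_mx V Z.
have UU : U^t* *m U = 1%:M.
  rewrite tr_row_mx map_col_mx mul_col_row VV VZ ZV ZZ.
  by rewrite -scalar_mx_block.
have UU' : U *m U^t* = 1%:M.
  (* [U] is square because [k] plus the sum of the [n i - 1] is the sum of the [n i], each [n i]
     being positive. *)
  apply: mulmx1_sym UU; rewrite -{1}(card_ord k) -sum1_card -big_split /=.
  by apply: eq_bigr => i _; rewrite add1n prednK.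
exists U; split.
- exact/unitarymxP.
- by apply/unitarymxP; rewrite trmxCK.
rewrite mul_row_block !mulmx0 addr0 add0r -AV -AZ -mul_mx_row -mulmxA.
by rewrite UU' mulmx1.
Qed.

End ReducingBlocks.
End Reducing.

(** * The converse of (b) and the assembly of the theorem *)

(** [M] is the compression of [A] along the isometry [U *m J], where [J] embeds the first summand.
    With (a), this yields equality of the radii. *)
Lemma numradius_dirsum_summand (R : realType) p q r (M : 'M[R[i]]_p)
    (N : 'M[R[i]]_q) (A : 'M[R[i]]_r) :
  unitarily_similar A (dirsum M N) -> numradius M <= numradius A.
Proof.
case=> U [_ /unitarymxP UU AE]; rewrite trmxCK in UU.
pose J : 'M[R[i]]_(p + q, p) := col_mx 1%:M 0.
have JE : J^t* = row_mx 1%:M 0.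
  by rewrite tr_col_mx map_row_mx trmx1 map_mx1 trmx0 map_mx0.
have JJ : J^t* *m J = 1%:M by rewrite JE mul_row_col mul1mx mul0mx addr0.
have -> : M = (U *m J)^t* *m A *m (U *m J).
  rewrite AE tC_mul !mulmxA -(mulmxA (J^t* )) UU mulmx1.
  rewrite -(mulmxA _ (U^t* )) UU mulmx1 JE mul_row_block mul_row_col.
  by rewrite !mul1mx !mul0mx !addr0 mulmx1 mulmx0 addr0.
apply: numradius_compression.
by rewrite tC_mul mulmxA -(mulmxA (J^t* )) UU mulmx1 JJ.
Qed.

Theorem theorem2p1 (R : realType) (k : nat) (hk : (2 <= k)%N)
    (n : 'I_k -> nat) (hn : forall i : 'I_k, (1 <= n i)%N)
    (A : forall i j : 'I_k, 'M[R[i]]_(n i, n j)) :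
  numradius (blockshift A) <= numradius (normshift A) /\
  ((forall i j : 'I_k, j = i.+1 :> nat -> A i j <> 0) ->
   (numradius (blockshift A) = numradius (normshift A) <->
    exists (l : nat) (m : 'I_l -> nat)
           (B : forall i j : 'I_l, 'M[R[i]]_(m i, m j)),
      [/\ (1 <= l)%N,
          numradius (blockshift B) <= numradius (normshift A) &
          unitarily_similar (blockshift A)
            (dirsum (normshift A) (blockshift B))])).
Proof.
have n0 : (0 < \sum_(i < k) n i)%N.
  by rewrite (bigD1 (Ordinal (ltnW hk))) //= addn_gt0 hn.
have leA := numradius_blockshift_le A n0.
split=> // A0; split=> [Aeq|[l [m [B [_ _ AB]]]]]; last first.
  by apply/le_anti; rewrite leA (numradius_dirsum_summand AB).
have [v [v1 Av]] := numradius_eq_reducing_vectors n0 A0 Aeq.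
have [B [BA AB]] := blockshift_decomposition hn v1 Av.
(* The complement keeps [k] blocks, each one dimension smaller; if all sizes become 0, the summand
   is absent. *)
exists k, (fun i => (n i).-1), B; split=> //; first exact: ltnW.
by rewrite -Aeq.
Qed.
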